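(* We have $\mathcal K(\ell^2(\mathbb Z))\subsetneq B_0(\ell^2(\mathbb Z))$, i.e. every compact operator on $\ell^2(\mathbb Z)$ belongs to $B_0(\ell^2(\mathbb Z))$, and there is a non-compact operator in $B_0(\ell^2(\mathbb Z))$.
   Context: The phase space is $\Xi=\mathbb Z\times\mathbb T$ ($\mathbb T$ the unit circle, written multiplicatively), acting on $\mathcal H=\ell^2(\mathbb Z)$ by the unitaries $U_{(k,\theta)}a(n)=\theta^na(n-k)$. For $A\in\mathcal L(\ell^2(\mathbb Z))$ put $\alpha_{(k,\theta)}(A)=U_{(k,\theta)}AU_{(k,\theta)}^\ast$. Let $\sigma\Xi$ be the maximal ideal space of the algebra $\operatorname{BUC}(\Xi)$ of bounded uniformly continuous functions on $\Xi$, a compactification of $\Xi$ via point evaluations, and $\partial\Xi=\sigma\Xi\setminus\Xi$. SOT$^\ast$ is the topology given by the seminorms $B\mapsto\|B\varphi\|$, $B\mapsto\|B^\ast\varphi\|$, $\varphi\in\mathcal H$. $B_0(\mathcal H)$ is the set of all $B\in\mathcal L(\mathcal H)$ such that $\alpha_{x_\gamma}(B)\to0$ in SOT$^\ast$ for every net $(x_\gamma)\subset\Xi$ converging in $\sigma\Xi$ to a point of $\partial\Xi$. $\mathcal K(\mathcal H)$ denotes the compact operators. *)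

(* Defs.v *)
From HB Require Import structures.
From mathcomp Require Import all_boot all_order all_algebra.
From mathcomp Require Import complex.
From mathcomp Require Import all_classical all_reals all_analysis.
From mathcomp Require Import summability.
From mathcomp Require Import ring lra.

Set Implicit Arguments.
Unset Strict Implicit.
Unset Printing Implicit Defensive.

Import Order.TTheory GRing.Theory Num.Theory.
Import numFieldNormedType.Exports.

Local Open Scope classical_set_scope.
Local Open Scope complex_scope.
Local Open Scope ring_scope.

(* R[i] gets the topology of its modulus and is a module over itself (which
   hides its structure of R-module). *)
HB.instance Definition _ (R : realType) := NormedModule.copy R[i] R[i]^o.

Section l2_space.
Variable R : realType.
Local Notation C := R[i].
Implicit Types a b : int -> C.

Definition modsq (z : C) : R := complex.Re z ^+ 2 + complex.Im z ^+ 2.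

Definition l2_mass a : \bar R := (\esum_(n in [set: int]) (modsq (a n))%:E)%E.

Definition l2_pred : {pred int -> C} := fun a => `[< (l2_mass a < +oo)%E >].

Lemma modsq_ge0 z : 0 <= modsq z.
Proof. by rewrite addr_ge0 ?sqr_ge0. Qed.

Lemma modsqE z : (modsq z)%:C = `|z| ^+ 2.
Proof.
case: z => x y; rewrite normc_def /modsq /= -rmorphXn /=.
by rewrite sqr_sqrtr// addr_ge0 ?sqr_ge0.
Qed.

Lemma modsqM z w : modsq (z * w) = modsq z * modsq w.
Proof. by case: z w => [x y] [u v]; rewrite /modsq /=; ring. Qed.

Lemma modsqD (t : R) z w : 0 < t ->
  modsq (z + w) <= (1 + t) * modsq z + (1 + t^-1) * modsq w.
Proof.
move=> t0; case: z w => [x y] [u v]; rewrite /modsq /=.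
have tV : t^-1 * t = 1 by rewrite mulVf ?gt_eqF.
have tV0 : 0 <= t^-1 by rewrite invr_ge0 ltW.
have h : forall p q : R, (p + q) ^+ 2 <= (1 + t) * p ^+ 2 + (1 + t^-1) * q ^+ 2.
  move=> p q; rewrite -subr_ge0.
  have -> : (1 + t) * p ^+ 2 + (1 + t^-1) * q ^+ 2 - (p + q) ^+ 2 =
            t^-1 * (t * p - q) ^+ 2 + (1 - t^-1 * t) * (t * p ^+ 2 - p * q *+ 2).
    by ring.
  by rewrite tV subrr mul0r addr0 mulr_ge0 ?sqr_ge0.
have := lerD (h x u) (h y v); lra.
Qed.

Lemma l2_mass_ge0 a : (0 <= l2_mass a)%E.
Proof. by apply: esum_ge0 => n _; rewrite lee_fin modsq_ge0. Qed.

Lemma le_modsq_mass a n : ((modsq (a n))%:E <= l2_mass a)%E.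
Proof.
apply: esum_ge; exists [set n]; first by split=> //; exact: finite_set1.
by rewrite fsbig_set1.
Qed.

Lemma esumZ_le (k : R) (f : int -> R) : 0 <= k -> (forall n, 0 <= f n) ->
  (\esum_(n in [set: int]) (k * f n)%:E <=
   k%:E * \esum_(n in [set: int]) (f n)%:E)%E.
Proof.
move=> k0 f0; apply: ge_ereal_sup => _ [A [Afin _] <-].
have -> : (\sum_(n \in A) (k * f n)%:E = k%:E * \sum_(n \in A) (f n)%:E)%E.
  by rewrite ge0_mule_fsumr// => n; rewrite lee_fin.
apply: lee_wpmul2l; first by rewrite lee_fin.
by apply: esum_ge; exists A.
Qed.

Lemma l2_massZ_le (c : C) a : (l2_mass (c *: a) <= (modsq c)%:E * l2_mass a)%E.
Proof.
apply: le_trans (esumZ_le (modsq_ge0 c) (fun n => modsq_ge0 (a n))).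
by apply: le_esum => n _; rewrite lee_fin modsqM.
Qed.

Lemma l2_massD_le (t : R) a b : 0 < t ->
  (l2_mass (a + b)%R <=
   (1 + t)%R%:E * l2_mass a + (1 + t^-1)%R%:E * l2_mass b)%E.
Proof.
move=> t0; have t1 : 0 <= 1 + t by rewrite addr_ge0 ?ltW.
have t2 : 0 <= 1 + t^-1 by rewrite addr_ge0 ?invr_ge0 ?ltW.
have ha := esumZ_le t1 (fun n => modsq_ge0 (a n)).
have hb := esumZ_le t2 (fun n => modsq_ge0 (b n)).
apply: le_trans (leeD ha hb).
rewrite -esumD; last 2 first.
- by move=> n _; rewrite lee_fin mulr_ge0 ?modsq_ge0.
- by move=> n _; rewrite lee_fin mulr_ge0 ?modsq_ge0.
by apply: le_esum => n _; rewrite -EFinD lee_fin modsqD.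
Qed.

Lemma l2_mass0 : l2_mass 0 = 0%E.
Proof. by apply: esum1 => n _; rewrite /modsq /= expr0n /= addr0. Qed.

Lemma l2_submod_closed : GRing.submod_closed l2_pred.
Proof.
split; first by apply/asboolP; rewrite l2_mass0 ltry.
move=> c a b /asboolP fa /asboolP fb; apply/asboolP.
apply: le_lt_trans (l2_massD_le _ _ ltr01) _.
apply: lte_add_pinfty; rewrite lte_mul_pinfty ?lee_fin ?addr_ge0 ?invr_ge0//.
apply: le_lt_trans (l2_massZ_le _ _) _.
by rewrite lte_mul_pinfty ?lee_fin ?modsq_ge0.
Qed.

HB.instance Definition _ :=
  GRing.isSubmodClosed.Build C (int -> C) l2_pred l2_submod_closed.

Record l2 := L2 { l2_val :> int -> C; _ : l2_val \in l2_pred }.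

HB.instance Definition _ := [isSub for l2_val].
HB.instance Definition _ := [Choice of l2 by <:].
HB.instance Definition _ := [SubChoice_isSubLmodule of l2 by <:].

Definition l2_norm (a : l2) : R := Num.sqrt (fine (l2_mass a)).

Lemma l2_mass_fin (a : l2) : (fine (l2_mass a))%:E = l2_mass a.
Proof.
apply: fineK; rewrite ge0_fin_numE ?l2_mass_ge0//.
by case: a => a /= /asboolP.
Qed.

Lemma fine_mass_ge0 (a : l2) : 0 <= fine (l2_mass a).
Proof. by rewrite fine_ge0 ?l2_mass_ge0. Qed.

Lemma l2_norm_ge0 (a : l2) : 0 <= l2_norm a.
Proof. exact: sqrtr_ge0. Qed.

Lemma l2_norm_sqr (a : l2) : l2_norm a ^+ 2 = fine (l2_mass a).
Proof. by rewrite sqr_sqrtr ?fine_mass_ge0. Qed.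

Lemma l2_norm0_eq0 (a : l2) : l2_norm a = 0 -> a = 0.
Proof.
move=> a0; apply/val_inj/funext => n /=; apply/eqP.
have := le_modsq_mass a n; rewrite -l2_mass_fin lee_fin -l2_norm_sqr a0 expr0n /=.
move=> h; have {}h : modsq (a n) = 0 by apply/eqP; rewrite eq_le h modsq_ge0.
have := modsqE (a n); rewrite h => /esym/eqP.
by rewrite sqrf_eq0 normr_eq0.
Qed.

Lemma l2_normD (a b : l2) : l2_norm (a + b) <= l2_norm a + l2_norm b.
Proof.
have [a0|a0] := eqVneq (l2_norm a) 0.
  by rewrite (l2_norm0_eq0 a0) add0r lerDr l2_norm_ge0.
have [b0|b0] := eqVneq (l2_norm b) 0.
  by rewrite (l2_norm0_eq0 b0) addr0 lerDl l2_norm_ge0.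
have {}a0 : 0 < l2_norm a by rewrite lt_def a0 l2_norm_ge0.
have {}b0 : 0 < l2_norm b by rewrite lt_def b0 l2_norm_ge0.
rewrite -(@ler_pXn2r _ 2)// ?nnegrE ?addr_ge0 ?l2_norm_ge0//.
rewrite l2_norm_sqr -lee_fin l2_mass_fin.
apply: le_trans (l2_massD_le a b (divr_gt0 b0 a0)) _.
rewrite -(l2_mass_fin a) -(l2_mass_fin b) -!l2_norm_sqr -!EFinM -EFinD lee_fin.
rewrite invf_div.
rewrite le_eqVlt; apply/orP; left; apply/eqP; field.
by rewrite !gt_eqF.
Qed.

Lemma l2_normZ (c : C) (a : l2) : (l2_norm (c *: a))%:C = `|c| * (l2_norm a)%:C.
Proof.
have le (c' : C) (a' : l2) : l2_norm (c' *: a') <= Num.sqrt (modsq c') * l2_norm a'.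
  rewrite -sqrtrM ?modsq_ge0// ler_sqrt ?mulr_ge0 ?modsq_ge0 ?fine_mass_ge0//.
  by rewrite -lee_fin EFinM !l2_mass_fin; exact: l2_massZ_le.
have nc (c' : C) : `|c'| = (Num.sqrt (modsq c'))%:C :> C.
  by case: c' => x y; rewrite normc_def.
rewrite nc -rmorphM /=; congr (_%:C); apply/eqP; rewrite eq_le le /=.
have [->|c0] := eqVneq c 0.
  by rewrite /modsq /= expr0n /= addr0 sqrtr0 mul0r l2_norm_ge0.
have := le c^-1 (c *: a); rewrite scalerA mulVf// scale1r.
have := nc c^-1; rewrite normfV nc -fmorphV /= => /complexI <-.
by rewrite -ler_pdivlMl // -?ltcR -?nc ?normr_gt0.
Qed.

Lemma l2_normcD (a b : l2) : (l2_norm (a + b))%:C <= (l2_norm a)%:C + (l2_norm b)%:C :> C.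
Proof. by rewrite -rmorphD /= lecR l2_normD. Qed.

Lemma l2_normc0 (a : l2) : (l2_norm a)%:C = 0 :> C -> a = 0.
Proof. by move/complexI/l2_norm0_eq0. Qed.

HB.instance Definition _ :=
  Lmodule_isNormed.Build C l2 l2_normcD l2_normZ l2_normc0.

End l2_space.

(* Summation is along the net of finite subsets of Z. *)
Definition inner (R : realType) (a b : l2 R) : R[i] :=
  summability.sum (fun n : int => a n * (b n)^*).

Record bounded_op (R : realType) := BoundedOp {
  op_lin :> {linear l2 R -> l2 R};
  op_bounded : exists M : R[i], forall phi, `|op_lin phi| <= M * `|phi| }.

HB.instance Definition _ (R : realType) := gen_eqMixin (bounded_op R).
HB.instance Definition _ (R : realType) := gen_choiceMixin (bounded_op R).

Section operators.
Variable R : realType.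
Local Notation C := R[i].
Implicit Types A B : bounded_op R.

Lemma op_comp_bounded A B :
  exists M : C, forall phi, `|(A \o B : {linear l2 R -> l2 R}) phi| <= M * `|phi|.
Proof.
case: (op_bounded A) (op_bounded B) => M HM [N HN].
exists (`|M| * N) => phi /=; apply: le_trans (HM _) _.
have hM : M * `|B phi| <= `|M| * `|B phi|.
  have [->|Bn0] := eqVneq `|B phi| 0; first by rewrite !mulr0.
  have B0 : 0 < `|B phi| by rewrite lt_def Bn0 normr_ge0.
  have M0 : 0 <= M.
    by rewrite -(pmulr_lge0 _ B0); apply: le_trans (HM _).
  by rewrite ger0_norm.
by apply: le_trans hM _; rewrite -mulrA ler_wpM2l.
Qed.

Definition op_comp A B : bounded_op R := BoundedOp (op_comp_bounded A B).

(* Every bounded operator has exactly one adjoint, so that the default value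
   of xget plays no role. *)
Definition adjoint A : bounded_op R :=
  xget A [set B | forall phi psi, inner (A phi) psi = inner phi (B psi)].

Definition compact_operators : set (bounded_op R) :=
  [set A | precompact [set A phi | phi in [set phi : l2 R | `|phi| <= 1]]].

End operators.

Arguments compact_operators : clear implicits.

Definition circle (R : realType) : Type := set_type [set z : R[i] | `|z| = 1].

HB.instance Definition _ (R : realType) := Uniform.on (circle R).

Definition phase (R : realType) : Type := (discrete_topology int * circle R)%type.

HB.instance Definition _ (R : realType) := Uniform.on (phase R).

Section phase_action.
Variable R : realType.
Local Notation C := R[i].
Implicit Types x : phase R.

Lemma circle_norm (z : circle R) : `|\val z| = 1.
Proof. by case: z => z /= /set_mem. Qed.

Definition trans_fun x (a : int -> C) : int -> C :=
  fun n => \val x.2 ^ n * a (n - (x.1 : int)).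

Lemma trans_mass x a : l2_mass (trans_fun x a) = l2_mass a.
Proof.
have z0 : \val x.2 != 0 by rewrite -normr_eq0 circle_norm oner_eq0.
have z1 n : modsq (\val x.2 ^ n) = 1.
  apply: (@complexI R); rewrite modsqE.
  suff -> : `|\val x.2 ^ n| = 1 by rewrite expr1n.
  by case: n => n; rewrite ?NegzE -?exprnN ?normfV normrX circle_norm expr1n ?invr1.
rewrite /l2_mass [RHS](@reindex_esum R _ _ setT setT (fun n => n - (x.1 : int))).
  by apply: eq_esum => n _; rewrite /trans_fun modsqM z1 mul1r.
split=> //; first by move=> m n _ _ /addIr.
by move=> n _; exists (n + (x.1 : int)) => //; rewrite addrK.
Qed.

Lemma trans_l2 x (a : l2 R) : trans_fun x a \in @l2_pred R.
Proof. by apply/asboolP; rewrite trans_mass; case: a => a /= /asboolP. Qed.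

Definition trans_l2_fun x (a : l2 R) : l2 R := L2 (trans_l2 x a).

Lemma trans_linear x : linear (trans_l2_fun x).
Proof.
move=> c a b; apply/val_inj/funext => n /=.
by rewrite /trans_fun /= mulrDr mulrCA.
Qed.

HB.instance Definition _ x :=
  GRing.isLinear.Build C (l2 R) (l2 R) _ (trans_l2_fun x) (trans_linear x).

Lemma trans_bounded x :
  exists M : C, forall phi, `|trans_l2_fun x phi| <= M * `|phi|.
Proof.
exists 1 => phi; rewrite mul1r.
suff -> : `|trans_l2_fun x phi| = `|phi| by [].
by congr (Num.sqrt (fine _))%:C; exact: trans_mass.
Qed.

Definition trans x : bounded_op R := BoundedOp (trans_bounded x).

Definition alpha x (A : bounded_op R) : bounded_op R :=
  op_comp (trans x) (op_comp A (adjoint (trans x))).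

End phase_action.

Section BUC.
Variable R : realType.
Local Notation C := R[i].

Definition buc_pred : {pred phase R -> C} := fun f =>
  `[< (exists M : C, forall x, `|f x| <= M) /\ unif_continuous f >].

Lemma unif_continuous_normP (f : phase R -> C) : unif_continuous f <->
  forall e : C, 0 < e ->
    entourage [set xy : phase R * phase R | `|f xy.1 - f xy.2| < e].
Proof.
split=> [fu e e0|fu V].
  have := fu [set xy | ball xy.1 e xy.2]; rewrite -ball_normE; apply.
  by rewrite -entourage_ballE; exists e => //; rewrite -ball_normE.
rewrite -entourage_ballE => -[e e0 eV].
apply: filterS (fu e e0) => xy /= h; apply: eV => /=.
by rewrite -ball_normE.
Qed.

Lemma buc_predP (f : phase R -> C) : reflect
  ((exists M : C, 0 <= M /\ forall x, `|f x| <= M) /\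
   forall e : C, 0 < e ->
    entourage [set xy : phase R * phase R | `|f xy.1 - f xy.2| < e])
  (f \in buc_pred).
Proof.
apply: (iffP (asboolP _)) => -[[M fM] fu]; split; try exact/unif_continuous_normP.
- exists `|M|; split=> // x; rewrite [leRHS]ger0_norm//.
  exact: le_trans (normr_ge0 _) (fM x).
- by exists M; case: fM.
Qed.

Lemma buc_cst (c : C) : (fun=> c) \in buc_pred.
Proof.
apply/buc_predP; split; first by exists `|c|.
by move=> e e0; apply: filterS filterT => xy _ /=; rewrite subrr normr0.
Qed.

Lemma buc_add (f g : phase R -> C) :
  f \in buc_pred -> g \in buc_pred -> f + g \in buc_pred.
Proof.
move=> /buc_predP[[M [M0 fM]] fu] /buc_predP[[N [N0 gN]] gu].
apply/buc_predP; split.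
  exists (M + N); split; first exact: addr_ge0.
  by move=> x; apply: le_trans (ler_normD _ _) (lerD _ _).
move=> e e0; have e20 : 0 < e / 2 by rewrite divr_gt0.
apply: filterS2 (fu _ e20) (gu _ e20) => xy /= hf hg.
rewrite /= opprD addrACA (splitr e).
by apply: le_lt_trans (ler_normD _ _) _; exact: ltrD.
Qed.

Lemma buc_mul (f g : phase R -> C) :
  f \in buc_pred -> g \in buc_pred -> f * g \in buc_pred.
Proof.
move=> /buc_predP[[M [M0 fM]] fu] /buc_predP[[N [N0 gN]] gu].
apply/buc_predP; split.
  exists (M * N); split; first exact: mulr_ge0.
  by move=> x; rewrite normrM ler_pM.
move=> e e0; set K := M + N + 1.
have K0 : 0 < K by rewrite ltr_wpDl ?addr_ge0.
have d0 : 0 < e / K by rewrite divr_gt0.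
apply: filterS2 (fu _ d0) (gu _ d0) => xy /= hf hg.
have -> : f xy.1 * g xy.1 - f xy.2 * g xy.2 =
    f xy.1 * (g xy.1 - g xy.2) + (f xy.1 - f xy.2) * g xy.2.
  by rewrite mulrBr mulrBl addrA subrK.
apply: le_lt_trans (ler_normD _ _) _; rewrite !normrM.
have h1 : `|f xy.1| * `|g xy.1 - g xy.2| <= M * (e / K).
  by rewrite ler_pM// ltW.
have h2 : `|f xy.1 - f xy.2| * `|g xy.2| <= (e / K) * N.
  by rewrite ler_pM// ltW.
apply: le_lt_trans (lerD h1 h2) _.
rewrite [_ * N]mulrC -mulrDl mulrA ltr_pdivrMr// mulrC ltr_pM2l//.
by rewrite ltrDl.
Qed.

Lemma buc_subring_closed : subring_closed buc_pred.
Proof.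
split; first exact: buc_cst.
  move=> f g fb gb; apply: buc_add fb _; rewrite -mulN1r.
  by apply: buc_mul gb; exact: (buc_cst (-1)).
by move=> f g; exact: buc_mul.
Qed.

HB.instance Definition _ :=
  GRing.isSubringClosed.Build (phase R -> C) buc_pred buc_subring_closed.

Lemma buc_scaler_closed : GRing.scaler_closed buc_pred.
Proof. by move=> c f; exact: buc_mul (buc_cst c). Qed.

HB.instance Definition _ :=
  GRing.isScaleClosed.Build C (phase R -> C) buc_pred buc_scaler_closed.

Record buc := Buc { buc_val :> phase R -> C; _ : buc_val \in buc_pred }.

HB.instance Definition _ := [isSub for buc_val].
HB.instance Definition _ := [Choice of buc by <:].
HB.instance Definition _ :=
  GRing.SubChoice_isSubComPzRing.Build (phase R -> C) buc_pred buc
    buc_subring_closed.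
HB.instance Definition _ := [SubZmodule_isSubLmodule of buc by <:].

(* Maximal ideals of the commutative C*-algebra BUC are identified with the
   characters of which they are the kernels; the topology is the Gelfand
   topology, that of pointwise convergence on BUC. *)
Definition is_character (chi : buc -> C) : Prop :=
  [/\ forall (c : C) (f g : buc), chi (c *: f + g) = c * chi f + chi g,
      forall f g : buc, chi (f * g) = chi f * chi g
    & chi 1 = 1].

Definition characters : set {ptws buc -> C} := [set chi | is_character chi].

Definition sigma_phase : Type := set_type characters.

HB.instance Definition _ := Topological.on sigma_phase.

Lemma eval_character (x : phase R) : is_character (fun f : buc => f x).
Proof. by split. Qed.

Definition point_eval (x : phase R) : sigma_phase :=
  SigSub (mem_set (eval_character x)).

Definition boundary : set sigma_phase := ~` range point_eval.

End BUC.

Definition directed (I : Type) (le : I -> I -> Prop) : Prop :=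
  [/\ inhabited I, forall i, le i i,
      forall i j k, le i j -> le j k -> le i k
    & forall i j, exists k, le i k /\ le j k].

Definition tails (I : Type) (le : I -> I -> Prop) : set_system I :=
  filter_from [set: I] (fun i => [set j | le i j]).

Definition sot_star_cvg0 (R : realType) (I : Type) (le : I -> I -> Prop)
    (T : I -> bounded_op R) : Prop :=
  forall phi : l2 R,
    `|T i phi| @[i --> tails le] --> (0 : R[i]) /\
    `|adjoint (T i) phi| @[i --> tails le] --> (0 : R[i]).

Definition B0 (R : realType) : set (bounded_op R) :=
  [set B | forall (I : Type) (le : I -> I -> Prop), directed le ->
     forall (x : I -> phase R) (chi : sigma_phase R), boundary chi ->
       point_eval (x i) @[i --> tails le] --> chi ->
       sot_star_cvg0 le (fun i => alpha (x i) B)].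

Arguments B0 : clear implicits.

(* Main.v *)
(* A net in the phase space that converges to a boundary point has its integer
   coordinate leaving every finite set: otherwise the indicator of {k} x T and
   the circle coordinate, both in BUC, would force the limit character to be a
   point evaluation. As U_(k,theta)^* maps the basis vector e_n to a unimodular
   multiple of e_(n-k), an operator B with |B e_n| -> 0 and |B^* e_n| -> 0 lies
   in B_0, by density of the finitely supported sequences. Compact operators
   have this property because e_n tends weakly to 0, uniformly against the
   relatively compact image of the unit ball. So does the orthogonal projection
   onto the span of the f_m = 2^(-m/2) sum_(2^m <= n < 2^(m+1)) e_n, which
   fixes infinitely many orthonormal vectors and hence is not compact. *)
From HB Require Import structures.
Require Import Defs.
From mathcomp Require Import all_boot all_order all_algebra.
From mathcomp Require Import finmap complex.
From mathcomp Require Import all_classical all_reals all_analysis.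
From mathcomp Require Import summability.
From mathcomp Require Import ring lra.

Set Implicit Arguments.
Unset Strict Implicit.
Unset Printing Implicit Defensive.

Import Order.TTheory GRing.Theory Num.Theory.
Import numFieldNormedType.Exports.

Local Open Scope classical_set_scope.
Local Open Scope complex_scope.
Local Open Scope ring_scope.

#[local] Existing Instance totally_filter.

(** * Limits of complex-valued functions along a filter *)

Section complex_limits.
Variables (R : realType) (T : Type) (F : set_system T).
Local Notation C := R[i].

(** Positive elements of [R[i]] have zero imaginary part, so tolerances may be taken in [R]. *)
Lemma cvg_complexP {FF : Filter F} (f : T -> C) (x : C) :
  f @ F --> x <-> forall e : R, 0 < e -> \forall t \near F, `|f t - x| < e%:C.
Proof.
split=> [/cvgrPdist_lt fx e e0|fx].
  have e0C : 0 < e%:C :> C by rewrite ltcR.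
  by apply: filterS (fx _ e0C) => t; rewrite distrC.
apply/cvgrPdist_lt => -[r s] /[dup] e0; rewrite ltcE /= => /andP[/eqP s0 r0].
by move: e0; rewrite s0 => _; apply: filterS (fx r r0) => t; rewrite distrC.
Qed.

Lemma lim_complex {FF : ProperFilter F} (f : T -> C) (x : C) :
  f @ F --> x -> lim (f @ F) = x.
Proof. exact: norm_cvg_lim. Qed.

Lemma eq_cvg_complex (f g : T -> C) (x : C) :
  f =1 g -> f @ F --> x -> g @ F --> x.
Proof. by move=> /funext ->. Qed.

Lemma cvg_complex_unique {FF : ProperFilter F} (f : T -> C) (x y : C) :
  f @ F --> x -> f @ F --> y -> x = y.
Proof. by move=> /lim_complex <- /lim_complex <-. Qed.

Lemma cvg_complex_linear {FF : Filter F} (c : C) (f g : T -> C) (x y : C) :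
  f @ F --> x -> g @ F --> y -> (fun t => c * f t + g t) @ F --> c * x + y.
Proof.
move=> /cvg_complexP fx /cvg_complexP gy; apply/cvg_complexP => e e0.
set k := Num.sqrt (modsq c).
have kE : `|c| = k%:C by case: c @k => u v; rewrite normc_def.
have k0 : 0 <= k by exact: sqrtr_ge0.
(* The [+ 1] keeps the denominator positive when [c = 0]; the same device recurs in later
   estimates. *)
have e1 : 0 < e / 2 / (k + 1) by rewrite !divr_gt0// ltr_wpDl.
have e2 : 0 < e / 2 by rewrite divr_gt0.
apply: filterS2 (fx _ e1) (gy _ e2) => t tx ty.
have -> : c * f t + g t - (c * x + y) = c * (f t - x) + (g t - y) by ring.
apply: le_lt_trans (ler_normD _ _) _; rewrite normrM.
have -> : e%:C = (e / 2)%:C + (e / 2)%:C by rewrite -rmorphD /= -splitr.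
apply: ler_ltD => //; apply: le_trans (ler_wpM2l (normr_ge0 _) (ltW tx)) _.
rewrite kE -rmorphM lecR mulrCA -[leRHS]mulr1 ler_wpM2l ?(ltW e2)//.
by rewrite ler_pdivrMr ?mul1r ?lerDl// ltr_wpDl.
Qed.

Lemma cvg_complex_conj {FF : Filter F} (f : T -> C) (x : C) :
  f @ F --> x -> (fun t => (f t)^*) @ F --> x^*.
Proof.
move=> /cvg_complexP fx; apply/cvg_complexP => e e0.
by apply: filterS (fx e e0) => t; rewrite -rmorphB norm_conjC.
Qed.

End complex_limits.

Arguments cvg_complex_linear {R T F FF} c {f g x y}.
Arguments cvg_complex_conj {R T F FF f x}.

(** * The inner product of [l2] through polarisation *)

Section inner_product.
Variable R : realType.
Local Notation C := R[i].
Implicit Types a b : l2 R.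

Lemma l2_normE a : `|a| = (l2_norm a)%:C.
Proof. by []. Qed.

Lemma l2P a b : a =1 b -> a = b.
Proof. by move=> ab; apply/val_inj/funext. Qed.

Lemma normc_modsq (z : C) : `|z| = (Num.sqrt (modsq z))%:C.
Proof. by case: z => x y; rewrite normc_def. Qed.

Lemma le_sum_mass (A : {fset int}) (a : int -> C) :
  ((\sum_(n <- A) modsq (a n))%:E <= l2_mass a)%E.
Proof.
apply: esum_ge; exists [set` A]; first by split => //; exact: finite_fset.
by rewrite fsbig_finite ?finite_fset//= set_fsetK sumEFin.
Qed.

Lemma l2_mass_adherent a (e : R) : 0 < e ->
  exists A : {fset int}, l2_norm a ^+ 2 - e < \sum_(n <- A) modsq (a n).
Proof.
move=> e0; have fin : l2_mass a \is a fin_num by rewrite -l2_mass_fin.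
have [_ [A [Afin _] <-]] := ub_ereal_sup_adherent e0 fin.
rewrite -/(esum _ _) -/(l2_mass a) -l2_mass_fin -l2_norm_sqr => h.
exists (fset_set A); move: h.
by rewrite fsbig_finite//= sumEFin -EFinB lte_fin.
Qed.

(** The squared norm is a supremum of finite sums of nonnegative terms. These sums grow with the
    index set, so the supremum is also their limit along [totally], the filter on which [inner] is
    built. *)
Lemma cvg_modsq a :
  partial_sum (fun n => (modsq (a n))%:C : C) @ totally --> (l2_norm a ^+ 2)%:C.
Proof.
apply/cvg_complexP => e e0; have [A hA] := l2_mass_adherent a e0.
exists A => //= B AB; rewrite /partial_sum.
rewrite -(big_seq_fsetE _ _ xpredT (fun n => (modsq (a n))%:C)) /=.
rewrite -rmorph_sum -rmorphB /= normc_modsq ltcR.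
have -> (x : R) : modsq x%:C = x ^+ 2 by rewrite /modsq /= expr0n /= addr0.
rewrite sqrtr_sqr distrC ger0_norm; last first.
  by rewrite subr_ge0 -lee_fin l2_norm_sqr l2_mass_fin le_sum_mass.
rewrite ltrBlDr -ltrBlDl (lt_le_trans hA)//.
rewrite [leRHS](big_fsetID _ (mem A)) /=.
have -> : [fset x in B | x \in A]%fset = A.
  apply/fsetP => n; rewrite !inE /=.
  by case: (boolP (n \in A)) => [/(fsubsetP AB)->|]; rewrite ?andbF.
by rewrite lerDl sumr_ge0// => n _; exact: modsq_ge0.
Qed.

Lemma partial_sum_linear (c : C) (f g : int -> C) A :
  partial_sum (fun n => c * f n + g n) A = c * partial_sum f A + partial_sum g A.
Proof. by rewrite /partial_sum big_split -mulr_sumr. Qed.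

(** The nesting that ends in [+ 0] is the shape left by four uses of [cvg_complex_linear], starting
    from the zero sum. *)
Lemma polarization (z w : C) :
  4^-1 * (modsq (z + w))%:C + (- 4^-1 * (modsq (z - w))%:C +
    ('i%C / 4 * (modsq (z + 'i%C * w))%:C +
      (- 'i%C / 4 * (modsq (z - 'i%C * w))%:C + 0))) = z * w^*.
Proof.
have -> : 4^-1 = (4^-1)%:C :> C by rewrite fmorphV rmorph_nat.
case: z w => [x y] [u v]; rewrite /modsq.
by apply/eqP; rewrite eq_complex /=; apply/andP; split; apply/eqP; field.
Qed.

(** As [inner] is a [lim], it carries information only once its partial sums are known to converge.
    Polarisation makes them combinations of four sums of squares, and [cvg_modsq] applies to
    each. *)
Lemma cvg_inner_polar a b :
  partial_sum (fun n => a n * (b n)^* : C) @ totally -->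
  4^-1 * `|a + b| ^+ 2 + (- 4^-1 * `|a - b| ^+ 2 +
    ('i%C / 4 * `|a + 'i%C *: b| ^+ 2 + (- 'i%C / 4 * `|a - 'i%C *: b| ^+ 2 + 0))).
Proof.
have cv0 : partial_sum (fun=> 0 : C) @ @totally int --> (0 : C).
  apply/cvg_complexP => e e0; apply: filterE => A.
  by rewrite /partial_sum big1// subrr normr0 ltcR.
have step (c : C) (d : l2 R) (f : int -> C) x : partial_sum f @ totally --> x ->
    partial_sum (fun n => c * (modsq (d n))%:C + f n) @ totally --> c * `|d| ^+ 2 + x.
  move=> fx; have -> : `|d| ^+ 2 = (l2_norm d ^+ 2)%:C by rewrite rmorphXn.
  refine (eq_cvg_complex _ (cvg_complex_linear c (@cvg_modsq d) fx)) => A.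
  by rewrite -partial_sum_linear.
have h := step 4^-1 (a + b) _ _ (step (- 4^-1) (a - b) _ _
  (step ('i%C / 4) (a + 'i%C *: b) _ _ (step (- 'i%C / 4) (a - 'i%C *: b) _ _ cv0))).
apply: (eq_cvg_complex _ h) => A; congr (partial_sum _ A); apply/funext => n.
exact: polarization.
Qed.

Lemma cvg_inner a b :
  partial_sum (fun n => a n * (b n)^* : C) @ totally --> inner a b.
Proof.
by have h := @cvg_inner_polar a b; rewrite /inner /summability.sum (lim_complex h).
Qed.

Lemma inner_linearl (c : C) a b d :
  inner (c *: a + b) d = c * inner a d + inner b d.
Proof.
apply: cvg_complex_unique (@cvg_inner _ _) _.
refine (eq_cvg_complex _ (cvg_complex_linear c (@cvg_inner a d) (@cvg_inner b d))) => A.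
rewrite -partial_sum_linear.
by congr partial_sum; apply/funext => n /=; rewrite mulrDl mulrA.
Qed.

Lemma innerC a b : inner a b = (inner b a)^*.
Proof.
apply: cvg_complex_unique (@cvg_inner _ _) _.
refine (eq_cvg_complex _ (cvg_complex_conj (@cvg_inner b a))) => A.
rewrite /partial_sum rmorph_sum; apply: eq_bigr => n _.
by rewrite rmorphM /= conjCK mulrC.
Qed.

Lemma inner_linearr (c : C) a b d :
  inner d (c *: a + b) = c^* * inner d a + inner d b.
Proof. by rewrite innerC inner_linearl rmorphD rmorphM /= -!innerC. Qed.

Lemma inner0l a : inner 0 a = 0.
Proof.
have := inner_linearl 1 0 0 a; rewrite scaler0 addr0 mul1r => /esym/eqP.
by rewrite -subr_eq0 addrK => /eqP.
Qed.

Lemma inner0r a : inner a 0 = 0.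
Proof. by rewrite innerC inner0l rmorph0. Qed.

Lemma innerZl (c : C) a b : inner (c *: a) b = c * inner a b.
Proof. by rewrite -[c *: a]addr0 inner_linearl inner0l addr0. Qed.

Lemma innerDl a b d : inner (a + b) d = inner a d + inner b d.
Proof. by rewrite -[a]scale1r inner_linearl mul1r scale1r. Qed.

Lemma innerZr (c : C) a b : inner a (c *: b) = c^* * inner a b.
Proof. by rewrite innerC innerZl rmorphM /= -innerC. Qed.

Lemma innerDr a b d : inner a (b + d) = inner a b + inner a d.
Proof. by rewrite innerC innerDl rmorphD /= -!innerC. Qed.

Lemma innerBl a b d : inner (a - b) d = inner a d - inner b d.
Proof. by rewrite innerDl -scaleN1r innerZl mulN1r. Qed.

Lemma inner_self a : inner a a = `|a| ^+ 2.
Proof.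
have -> : `|a| ^+ 2 = (l2_norm a ^+ 2)%:C by rewrite rmorphXn.
refine (cvg_complex_unique (@cvg_inner a a) (eq_cvg_complex _ (@cvg_modsq a))) => A.
by congr (partial_sum _ A); apply/funext => n; rewrite modsqE normCK.
Qed.

(** By the triangle inequality each of the four polarisation terms is at most a quarter of the
    right-hand side. *)
Lemma inner_le_sqrD a b : `|inner a b| <= (`|a| + `|b|) ^+ 2.
Proof.
rewrite (cvg_complex_unique (@cvg_inner a b) (@cvg_inner_polar a b)) addr0.
have n4 : `|4^-1| = 4^-1 :> C by rewrite ger0_norm// invr_ge0.
have ni : `|'i%C| = 1 :> C.
  by rewrite normc_modsq /modsq /= expr0n expr1n add0r sqrtr1.
have q (c : C) d : `|c| = 4^-1 -> `|d| <= `|b| ->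
    `|c * `|a + d| ^+ 2| <= 4^-1 * (`|a| + `|b|) ^+ 2.
  move=> cE db; rewrite normrM cE normrX normr_id ler_wpM2l ?invr_ge0//.
  rewrite ler_pXn2r ?nnegrE ?addr_ge0//.
  by apply: le_trans (ler_normD _ _) _; rewrite lerD2l.
have -> : (`|a| + `|b|) ^+ 2 = 4^-1 * (`|a| + `|b|) ^+ 2 + (4^-1 * (`|a| + `|b|) ^+ 2 +
   (4^-1 * (`|a| + `|b|) ^+ 2 + 4^-1 * (`|a| + `|b|) ^+ 2)) :> C by field.
apply: le_trans (ler_normD _ _) (lerD _ _); first exact: (q _ b).
apply: le_trans (ler_normD _ _) (lerD _ _); first by apply: (q _ (- b)); rewrite normrN.
apply: le_trans (ler_normD _ _) (lerD _ _); apply: q.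
- by rewrite normrM ni n4 mul1r.
- by rewrite normrZ ni mul1r.
- by rewrite normrM normrN ni n4 mul1r.
- by rewrite normrN normrZ ni mul1r.
Qed.

(* Polarisation gives the crude constant 4, which is enough everywhere below. *)
Lemma inner_le a b : `|inner a b| <= 4 * `|a| * `|b|.
Proof.
have [->|a0] := eqVneq a 0; first by rewrite inner0l !normr0 mulr0 mul0r.
have [->|b0] := eqVneq b 0; first by rewrite inner0r !normr0 mulr0.
have na : 0 < `|a| by rewrite normr_gt0.
have nb : 0 < `|b| by rewrite normr_gt0.
have unit (d : l2 R) : d != 0 -> `| `|d|^-1 *: d | = 1.
  by move=> d0; rewrite normrZ normfV normr_id mulVf// normr_eq0.
have := inner_le_sqrD (`|a|^-1 *: a) (`|b|^-1 *: b).
rewrite !unit// innerZl innerZr !normrM norm_conjC !normfV !normr_id.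
have -> : (1 + 1) ^+ 2 = 4 :> C by ring.
rewrite ler_pdivrMl// ler_pdivrMl// => h; apply: le_trans h _.
by rewrite le_eqVlt; apply/orP; left; apply/eqP; ring.
Qed.

End inner_product.

(** * The standard basis and density of finitely supported sequences *)

Section standard_basis.
Variable R : realType.
Local Notation C := R[i].
Implicit Types a b : l2 R.

Definition basis_fun (n : int) : int -> C := fun m => (m == n)%:R.

Lemma basis_mass n : l2_mass (basis_fun n) = 1%E.
Proof.
have -> : l2_mass (basis_fun n) = (\esum_(i in [set n]) 1)%E.
  rewrite esum_mkcond; apply: eq_esum => m _; rewrite /basis_fun.
  have -> : (m \in [set n]) = (m == n) by apply/idP/eqP; rewrite inE.
  by case: eqP => _; rewrite /modsq /= ?expr1n expr0n addr0.
by rewrite esum_set1.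
Qed.

Lemma basis_fun_l2 n : basis_fun n \in @l2_pred R.
Proof. by apply/asboolP; rewrite basis_mass ltry. Qed.

Definition l2_basis n : l2 R := L2 (basis_fun_l2 n).

Lemma l2_norm_basis n : l2_norm (l2_basis n) = 1.
Proof. by rewrite /l2_norm basis_mass sqrtr1. Qed.

Lemma norm_basis n : `|l2_basis n| = 1.
Proof. by rewrite l2_normE l2_norm_basis. Qed.

Lemma inner_basisr a n : inner a (l2_basis n) = a n.
Proof.
refine (cvg_complex_unique (@cvg_inner _ a (l2_basis n)) _).
apply/cvg_complexP => e e0; exists [fset n]%fset => //= A /=; rewrite fsub1set => nA.
rewrite /partial_sum -(big_seq_fsetE _ _ xpredT (fun m => a m * (l2_basis n m)^*)) /=.
rewrite (big_fsetD1 n) //= big_seq big1 => [|m].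
  by rewrite /basis_fun eqxx conjC1 mulr1 addr0 subrr normr0 ltcR.
by rewrite in_fsetD1 /basis_fun => /andP[/negPf -> _]; rewrite conjC0 mulr0.
Qed.

Lemma inner_basisl a n : inner (l2_basis n) a = (a n)^*.
Proof. by rewrite innerC inner_basisr. Qed.

Lemma norm_coord_le a n : `|a n| <= `|a|.
Proof.
have := le_modsq_mass a n; rewrite -l2_mass_fin lee_fin => h.
by rewrite normc_modsq l2_normE lecR ler_sqrt// fine_mass_ge0.
Qed.

Definition truncation (A : {fset int}) (a : int -> C) : l2 R :=
  \sum_(n <- A) a n *: l2_basis n.

Lemma truncationE A (a : int -> C) m : truncation A a m = if m \in A then a m else 0.
Proof.
rewrite /truncation (big_morph (fun b : l2 R => b m) (id1 := 0) (op1 := +%R))//.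
rewrite (eq_bigr (fun n => a n * (m == n)%:R : C))//.
case: ifPn => [mA|mA].
  rewrite (big_fsetD1 m)//= eqxx mulr1 big_seq big1 ?addr0// => n.
  by rewrite in_fsetD1 eq_sym => /andP[/negPf -> _]; rewrite mulr0.
rewrite big_seq big1// => n nA; case: eqP nA mA => [->->//|_ _ _].
by rewrite mulr0.
Qed.

Lemma truncation_approx a (e : R) : 0 < e -> exists A, l2_norm (a - truncation A a) <= e.
Proof.
move=> e0; have [A hA] := l2_mass_adherent a (exprn_gt0 2 e0); exists A.
rewrite -(@ler_pXn2r _ 2)// ?nnegrE ?l2_norm_ge0 ?(ltW e0)//.
move: hA; rewrite ltrBlDr -ltrBlDl => /ltW; apply: le_trans.
rewrite lerBrDl !l2_norm_sqr -lee_fin EFinD !l2_mass_fin.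
(* The truncation error is 0 on [A] and equals [a] elsewhere, so its mass is the part of the mass of
   [a] carried by the complement. *)
rewrite [leRHS](esumID [set` A]); last by move=> n _; rewrite lee_fin modsq_ge0.
rewrite !setTI leeD//.
  rewrite esum_fset ?finite_fset//; last by move=> n _; rewrite lee_fin modsq_ge0.
  by rewrite fsbig_finite ?finite_fset//= set_fsetK sumEFin.
rewrite esum_mkcond; apply: le_esum => n _.
have -> : (a - truncation A a) n = a n - truncation A a n by [].
have -> : (n \in ~` [set` A]) = (n \notin A) 
  by rewrite in_setC; congr negb; apply/idP/idP => [/set_mem|/mem_set].
rewrite truncationE; case: ifP => _ /=; rewrite ?subr0// subrr.
by rewrite /modsq expr0n addr0.
Qed.

(** Density as an induction principle: a closed subspace containing the basis is everything, since
    every vector is a norm limit of its truncations. *)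
Lemma l2_basis_ind (P : set (l2 R)) :
  (forall c a b, P a -> P b -> P (c *: a + b)) -> (forall n, P (l2_basis n)) ->
  (forall a, (forall e : R, 0 < e -> exists2 b, P b & l2_norm (a - b) <= e) -> P a) ->
  forall a, P a.
Proof.
move=> Plin Pb Pcl a; apply: Pcl => e e0; have [A hA] := truncation_approx a e0.
exists (truncation A a) => //; rewrite /truncation.
elim/big_rec: _ => [|n b _ Pb']; last exact: Plin.
(* The empty sum needs [P 0], obtained as -e_0 + e_0. *)
by have := Plin (-1) _ _ (Pb 0) (Pb 0); rewrite scaleN1r addNr.
Qed.

(** Outside [A] the coordinates of [a] are those of a small truncation error. In other words, e_n
    tends weakly to 0. *)
Lemma coord_cvg0 a (e : R) : 0 < e ->
  exists A : {fset int}, forall n, n \notin A -> `|a n| <= e%:C.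
Proof.
move=> e0; have [A hA] := truncation_approx a e0; exists A => n nA.
apply: le_trans (_ : `|(a - truncation A a) n| <= _).
  have -> : (a - truncation A a) n = a n - truncation A a n by [].
  by rewrite truncationE (negPf nA) subr0.
by apply: le_trans (norm_coord_le _ _) _; rewrite l2_normE lecR.
Qed.

End standard_basis.

(** * Existence and uniqueness of adjoints *)

Section adjoints.
Variable R : realType.
Local Notation C := R[i].
Implicit Types (A B : bounded_op R) (a b phi psi : l2 R).

Lemma l2_mass_le (a : int -> C) (K : R) :
  (forall F : {fset int}, \sum_(n <- F) modsq (a n) <= K) -> (l2_mass a <= K%:E)%E.
Proof.
move=> aK; apply: ge_ereal_sup => _ [F [Ffin _] <-].
by rewrite fsbig_finite//= sumEFin lee_fin.
Qed.

Lemma op_bound A :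
  exists2 M : R, 0 <= M & forall phi, l2_norm (A phi) <= M * l2_norm phi.
Proof.
have [M AM] := op_bounded A; exists (Num.sqrt (modsq M)); first exact: sqrtr_ge0.
move=> phi; rewrite -lecR rmorphM /= -normc_modsq -!l2_normE.
apply: le_trans (AM phi) _; have [->|phi0] := eqVneq phi 0.
  by rewrite normr0 !mulr0.
have n0 : 0 < `|phi| by rewrite normr_gt0.
rewrite ler_pM2r//; apply: real_ler_norm; apply: ger0_real.
by rewrite -(pmulr_lge0 _ n0); apply: le_trans (AM phi).
Qed.

Lemma inner_leR a b : `|inner a b| <= (4 * l2_norm a * l2_norm b)%:C.
Proof. by rewrite !rmorphM /= rmorph_nat -!l2_normE inner_le. Qed.

Lemma sqr_l2_norm_truncation (F : {fset int}) (a : int -> C) :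
  l2_norm (truncation F a) ^+ 2 = \sum_(n <- F) modsq (a n).
Proof.
apply: (@complexI R); rewrite rmorphXn /= -l2_normE -inner_self {1}/truncation.
rewrite (big_morph (fun b => inner b _) (fun b d => innerDl b d _) (inner0l _)).
rewrite rmorph_sum /= !big_seq; apply: eq_bigr => n nF.
by rewrite innerZl inner_basisl truncationE nF modsqE normCK.
Qed.

(** The only possible coordinates: the n-th one of A^* psi is the inner product of A^* psi with e_n,
    the conjugate of that of A e_n with psi. *)
Definition adjoint_fun A psi : int -> C := fun n => (inner (A (l2_basis R n)) psi)^*.

(** Test [A] on a truncation v of the candidate sequence itself: the inner product of A v with psi
    equals |v|^2 and is at most 4 M |v| |psi|. Dividing by |v| bounds all finite sums at once. *)
Lemma adjoint_mass A (M : R) psi : 0 <= M ->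
  (forall phi, l2_norm (A phi) <= M * l2_norm phi) ->
  (l2_mass (adjoint_fun A psi) <= ((4 * M * l2_norm psi) ^+ 2)%:E)%E.
Proof.
move=> M0 AM; apply: l2_mass_le => F; rewrite -sqr_l2_norm_truncation.
set v := truncation F _.
rewrite ler_pXn2r ?nnegrE ?mulr_ge0 ?l2_norm_ge0//.
have [->|v0] := eqVneq (l2_norm v) 0; first by rewrite !mulr_ge0 ?l2_norm_ge0.
have {}v0 : 0 < l2_norm v by rewrite lt_def v0 l2_norm_ge0.
rewrite -(ler_pM2r v0) -expr2.
have e : inner (A v) psi = (l2_norm v ^+ 2)%:C.
  rewrite {1}/v /truncation linear_sum /= sqr_l2_norm_truncation rmorph_sum /=.
  rewrite (big_morph (fun b => inner b _) (fun b d => innerDl b d _) (inner0l _)).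
  apply: eq_bigr => n _; rewrite linearZ /= innerZl modsqE normCK.
  by rewrite /adjoint_fun conjCK.
have := inner_leR (A v) psi; rewrite e ger0_norm ?lecR ?sqr_ge0//.
move/le_trans; apply.
have -> : 4 * M * l2_norm psi * l2_norm v = 4 * (M * l2_norm v) * l2_norm psi by ring.
by rewrite ler_wpM2r ?l2_norm_ge0// ler_pM2l.
Qed.

Lemma adjoint_fun_l2 A psi : adjoint_fun A psi \in @l2_pred R.
Proof.
have [M M0 AM] := op_bound A.
by apply/asboolP; apply: le_lt_trans (adjoint_mass psi M0 AM) (ltry _).
Qed.

Definition adjoint_l2 A psi : l2 R := L2 (adjoint_fun_l2 A psi).

Lemma adjoint_linear A : linear (adjoint_l2 A).
Proof.
move=> c a b; apply: l2P => n.
by rewrite /= /adjoint_fun inner_linearr rmorphD rmorphM /= conjCK.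
Qed.

HB.instance Definition _ A :=
  GRing.isLinear.Build C (l2 R) (l2 R) _ (adjoint_l2 A) (adjoint_linear A).

Lemma adjoint_bounded A : exists M : C, forall phi, `|adjoint_l2 A phi| <= M * `|phi|.
Proof.
have [M M0 AM] := op_bound A; exists (4 * M)%:C => phi.
rewrite !l2_normE -rmorphM lecR.
rewrite -(@ler_pXn2r _ 2)// ?nnegrE ?mulr_ge0 ?l2_norm_ge0//.
by rewrite l2_norm_sqr -lee_fin l2_mass_fin adjoint_mass.
Qed.

Definition is_adjoint A B := forall phi psi, inner (A phi) psi = inner phi (B psi).

Lemma complex_eq0_small (z : C) (K : R) : 0 <= K ->
  (forall e : R, 0 < e -> `|z| <= (K * e)%:C) -> z = 0.
Proof.
move=> K0 zK; apply/eqP; rewrite -normr_eq0; apply/eqP.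
move: zK; rewrite normc_modsq; set r := Num.sqrt _ => zK; congr (_%:C).
apply/eqP; rewrite eq_le sqrtr_ge0 andbT; apply/ler_addgt0Pl => e e0.
have K1 : 0 < K + 1 by rewrite ltr_wpDl.
have := zK _ (divr_gt0 e0 K1); rewrite lecR addr0 => /le_trans; apply.
by rewrite mulrCA ger_pMr// ler_pdivrMr// mul1r lerDl.
Qed.

(** For fixed [psi] both sides are linear and continuous in [phi] and agree on the basis, so density
    applies. *)
Lemma is_adjoint_adjoint_l2 A : is_adjoint A (BoundedOp (adjoint_bounded A)).
Proof.
move=> phi psi; move: phi; apply: l2_basis_ind => [c a b aP bP|n|a aP].
- by rewrite linearP !inner_linearl aP bP.
- by rewrite inner_basisl /= conjCK.
- have [M M0 AM] := op_bound A.
  apply/eqP; rewrite -subr_eq0; apply/eqP.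
  (* The two summands bound the two sides at [a - b], each by [inner_leR]; at [b] the sides
     agree. *)
  apply: (@complex_eq0_small _ (4 * M * l2_norm psi + 4 * l2_norm (adjoint_l2 A psi))).
    by rewrite addr_ge0// !mulr_ge0 ?l2_norm_ge0.
  move=> e e0; have [b Pb ab] := aP e e0.
  have -> : inner (A a) psi - inner a (adjoint_l2 A psi) =
      inner (A (a - b)) psi - inner (a - b) (adjoint_l2 A psi).
    by rewrite linearB !innerBl Pb /=; ring.
  apply: le_trans (ler_normB _ _) _; rewrite mulrDl rmorphD /=; apply: lerD.
    apply: le_trans (inner_leR _ _) _; rewrite lecR -!mulrA ler_pM2l//.
    rewrite [l2_norm psi * e]mulrC mulrA ler_wpM2r ?l2_norm_ge0//.
    by apply: le_trans (AM _) _; rewrite ler_wpM2l.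
  apply: le_trans (inner_leR _ _) _; rewrite lecR -!mulrA ler_pM2l//.
  by rewrite mulrC ler_wpM2l ?l2_norm_ge0.
Qed.

(** Existence is now known, so the choice made by [xget] is a genuine adjoint and not the default
    value. *)
Lemma adjointP A : is_adjoint A (adjoint A).
Proof.
apply: (xgetPex A); exists (BoundedOp (adjoint_bounded A)).
exact: is_adjoint_adjoint_l2.
Qed.

Lemma is_adjoint_sym A B : is_adjoint A B -> is_adjoint B A.
Proof. by move=> AB phi psi; rewrite innerC -AB -innerC. Qed.

Lemma is_adjoint_unique A B B' : is_adjoint A B -> is_adjoint A B' -> B =1 B'.
Proof.
move=> AB AB' psi; apply: l2P => n; apply: (inv_inj (@conjCK _)).
by rewrite -!inner_basisl -AB -AB'.
Qed.

End adjoints.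

(** * Conjugation by phase space translations *)

Section translations.
Variable R : realType.
Local Notation C := R[i].
Implicit Types (A B D : bounded_op R) (x : phase R) (a b phi psi : l2 R).

Lemma l2_norm_trans x phi : l2_norm (trans x phi) = l2_norm phi.
Proof. by congr (Num.sqrt (fine _)); exact: trans_mass. Qed.

(** With psi = U^* phi, |psi|^2 is the inner product of U psi with phi, and U is isometric. The
    factor 4 comes from [inner_leR]; only its independence of [x] matters. *)
Lemma l2_norm_adjoint_trans x phi : l2_norm (adjoint (trans x) phi) <= 4 * l2_norm phi.
Proof.
set psi := adjoint _ _; have [->|n0] := eqVneq (l2_norm psi) 0.
  by rewrite mulr_ge0 ?l2_norm_ge0.
have {}n0 : 0 < l2_norm psi by rewrite lt_def n0 l2_norm_ge0.
rewrite -(ler_pM2r n0) -expr2.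
have e : inner (trans x psi) phi = (l2_norm psi ^+ 2)%:C.
  by rewrite adjointP inner_self l2_normE -rmorphXn.
have := inner_leR (trans x psi) phi; rewrite e ger0_norm ?lecR ?sqr_ge0//.
by rewrite l2_norm_trans mulrAC.
Qed.

Lemma norm_circle_exp (z : circle R) (n : int) : `|\val z ^ n| = 1.
Proof.
by case: n => n; rewrite ?NegzE -?exprnN ?normfV normrX circle_norm expr1n ?invr1.
Qed.

Lemma adjoint_trans_basis x n :
  adjoint (trans x) (l2_basis R n) = (\val x.2 ^ n)^* *: l2_basis R (n - (x.1 : int)).
Proof.
apply: l2P => m; apply: (inv_inj (@conjCK _)).
rewrite -inner_basisl -adjointP inner_basisr.
transitivity (\val x.2 ^ n * (n - (x.1 : int) == m)%:R) => //.
rewrite -[LHS]conjCK; congr (_^*).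
by rewrite rmorphM /= rmorph_nat eq_sym.
Qed.

Lemma is_adjoint_alpha x A B : is_adjoint A B -> is_adjoint (alpha x A) (alpha x B).
Proof.
move=> AB phi psi /=; have V := adjointP (trans x).
by rewrite -[LHS]/(inner (trans x _) psi) V /= AB (is_adjoint_sym V).
Qed.

Lemma adjoint_alpha x A : adjoint (alpha x A) =1 alpha x (adjoint A).
Proof.
exact: is_adjoint_unique (adjointP _) (is_adjoint_alpha x (adjointP A)).
Qed.

(** Finite exceptional sets handle both ends of the integers together. *)
Definition null_on_basis D := forall e : R, 0 < e ->
  exists A : {fset int}, forall n, n \notin A -> l2_norm (D (l2_basis R n)) <= e.

Lemma l2_normZR (c : C) a : l2_norm (c *: a) = Num.sqrt (modsq c) * l2_norm a.
Proof.
by apply: (@complexI R); rewrite rmorphM /= -normc_modsq -!l2_normE normrZ.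
Qed.

Section nets.
Variables (I : Type) (F : set_system I) (FF : Filter F) (x : I -> phase R).
Hypothesis xoo : forall k : int, \forall i \near F, ((x i).1 : int) != k.

Lemma near_notin (A : {fset int}) (n : int) :
  \forall i \near F, n - ((x i).1 : int) \notin A.
Proof.
have [s -> ] : exists s : seq int, A = [fset m in s]%fset.
  by exists (enum_fset A); apply/fsetP => m; rewrite inE.
elim: s => [|m s IHs]; first by apply: filterE => i; rewrite inE.
apply: filterS2 (xoo (n - m)) IHs => i; rewrite !inE negb_or => h ->; rewrite andbT.
by apply: contra h => /eqP <-; rewrite opprB addrC subrK.
Qed.

(** The operators [alpha (x i) D] are bounded uniformly in [i], so the vectors on which they tend to
    0 form a closed subspace. It contains e_n because the index n - k_i eventually avoids every
    finite set. *)
Lemma alpha_small D phi (e : R) : null_on_basis D -> 0 < e ->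
  \forall i \near F, l2_norm (alpha (x i) D phi) <= e.
Proof.
move=> Dnull; have [M M0 DM] := op_bound D; move: phi e.
apply: l2_basis_ind => [c a b aP bP e e0|n e e0|a aP e e0].
- set k := Num.sqrt (modsq c).
  have k0 : 0 < k + 1 by rewrite ltr_wpDl ?sqrtr_ge0.
  have e1 : 0 < e / 2 / (k + 1) by rewrite !divr_gt0.
  have e2 : 0 < e / 2 by rewrite divr_gt0.
  apply: filterS2 (aP _ e1) (bP _ e2) => i ai bi.
  rewrite linearP (splitr e); apply: le_trans (l2_normD _ _) _; apply: lerD => //.
  rewrite l2_normZR -/k; apply: le_trans (ler_wpM2l _ ai) _; first exact: sqrtr_ge0.
  by rewrite mulrCA ger_pMr// ler_pdivrMr// mul1r lerDl.
- have [A hA] := Dnull e e0; apply: filterS (near_notin A n) => i /hA.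
  rewrite /= l2_norm_trans adjoint_trans_basis linearZ /= l2_normZR.
  suff -> : Num.sqrt (modsq (\val (x i).2 ^ n)^*) = 1 by rewrite mul1r.
  by apply: (@complexI R); rewrite -normc_modsq norm_conjC norm_circle_exp.
- have e2 : 0 < e / 2 by rewrite divr_gt0.
  (* [M * 4] is the uniform bound: [M] from [D], 4 from [l2_norm_adjoint_trans]. *)
  have K0 : 0 < M * 4 + 1 by rewrite ltr_wpDl ?mulr_ge0.
  have [b bP ab] := aP _ (divr_gt0 e2 K0).
  apply: filterS (bP _ e2) => i bi; rewrite -(subrK b a) linearD (splitr e).
  apply: le_trans (l2_normD _ _) (lerD _ bi).
  rewrite /= l2_norm_trans; apply: le_trans (DM _) _.
  apply: le_trans (ler_wpM2l M0 (l2_norm_adjoint_trans _ _)) _; rewrite mulrA.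
  apply: le_trans (ler_wpM2l _ ab) _; first by rewrite mulr_ge0.
  by rewrite mulrCA ger_pMr// ler_pdivrMr// mul1r lerDl.
Qed.

Lemma norm_small_cvg0 (f : I -> l2 R) :
  (forall e, 0 < e -> \forall i \near F, l2_norm (f i) <= e) ->
  `|f i| @[i --> F] --> (0 : C).
Proof.
move=> fs; apply/cvg_complexP => e e0; have e2 : 0 < e / 2 by rewrite divr_gt0.
apply: filterS (fs _ e2) => i fi; rewrite subr0 normr_id l2_normE ltcR.
by apply: le_lt_trans fi _; rewrite ltr_pdivrMr// ltr_pMr// ltr1n.
Qed.

End nets.

End translations.

(** * Nets converging to boundary points *)

Section boundary_nets.
Variable R : realType.
Local Notation C := R[i].

(** The integer factor is discrete, so sufficiently close points share their integer coordinate and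
    only the distance on the circle remains. *)
Lemma phase_entourageP (E : set (phase R * phase R)) : entourage E <->
  exists2 e : R, 0 < e & forall x y : phase R, x.1 = y.1 ->
    `|\val x.2 - \val y.2| < e%:C -> E (x, y).
Proof.
split=> [[[P Q] /= [entP [V entV VQ]] PQE]|[e e0 eE]].
  move: entV; rewrite -entourage_ballE => -[[e d] /= e0 eV].
  move: e0; rewrite ltcE /= => /andP[/eqP d0 e0].
  exists e => // x y xy1 xy2.
  have Px : P (x.1, y.1) by rewrite xy1; exact: entourage_refl.
  have Qx : Q (x.2, y.2).
    by apply: VQ => /=; apply: eV => /=; rewrite d0 -ball_normE.
  have [[[a b] [c b']] Exy /= [h1 h2 h3 h4]] := PQE ((x.1, y.1), (x.2, y.2)) (conj Px Qx).
  by move: Exy; rewrite h1 h2 h3 h4; case: (x) (y) => [? ?] [? ?].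
have e0C : 0 < e%:C :> C by rewrite ltcR.
pose V : set (circle R * circle R) := [set xy | `|\val xy.1 - \val xy.2| < e%:C].
have entV : entourage V.
  exists [set xy : C * C | ball xy.1 e%:C xy.2].
    by rewrite -entourage_ballE; exists e%:C.
  by move=> xy /=; rewrite -ball_normE.
have entD : entourage [set xy : discrete_topology int * discrete_topology int | xy.1 = xy.2].
  by move=> _ [a _ <-].
have := @prod_entP _ _ _ _ entD entV; apply: filterS => -[x y] /= [xy1 xy2].
exact: eE.
Qed.

Definition index_indicator (k : int) : phase R -> C := fun x => ((x.1 : int) == k)%:R.

Definition circle_coord : phase R -> C := fun x => \val x.2.

Lemma index_indicator_buc k : index_indicator k \in @buc_pred R.
Proof.
apply/buc_predP; split.
  by exists 1; split=> // x; rewrite /index_indicator; case: eqP => _;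
    rewrite ?normr1 ?normr0.
move=> e e0; apply/phase_entourageP; exists 1 => // x y xy _ /=.
by rewrite /index_indicator xy subrr normr0.
Qed.

Lemma circle_coord_buc : circle_coord \in @buc_pred R.
Proof.
apply/buc_predP; split; first by exists 1; split=> // x; rewrite circle_norm.
move=> [e d] /= e0; move: (e0); rewrite ltcE /= => /andP[/eqP d0 e0'].
by apply/phase_entourageP; exists e => // x y _ /=; rewrite d0.
Qed.

(** The topology is that of pointwise convergence, so evaluation at [f] is continuous. *)
Lemma sigma_phase_cvg (I : Type) (F : set_system I) (x : I -> phase R)
    (chi : sigma_phase R) (f : buc R) : Filter F ->
  point_eval (x i) @[i --> F] --> chi -> f (x i) @[i --> F] --> \val chi f.
Proof.
move=> FF xchi.
pose ev (c : sigma_phase R) := (\val c : {ptws buc R -> C}) f.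
have evc : {for chi, continuous ev}.
  apply: (@continuous_comp _ _ _ (\val : sigma_phase R -> {ptws buc R -> C}) (fun g => g f)).
    exact: initial_continuous.
  exact: proj_continuous.
exact: (cvg_comp _ _ xchi evc).
Qed.

Lemma buc_cvg (I : Type) (F : set_system I) (x : I -> phase R) (y : phase R) (f : buc R) :
  Filter F -> (\forall i \near F, (x i).1 = y.1) ->
  \val (x i).2 @[i --> F] --> \val y.2 -> f (x i) @[i --> F] --> f y.
Proof.
move=> FF x1 /cvg_complexP x2; apply/cvg_complexP => e e0.
have e0C : 0 < e%:C :> C by rewrite ltcR.
have /buc_predP[_ /(_ _ e0C)/phase_entourageP[d d0 df]] := valP f.
by apply: filterS2 x1 (x2 _ d0) => i i1 i2; exact: (df (x i) y).
Qed.

Lemma boundary_index_neq (I : Type) (F : set_system I) (x : I -> phase R)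
    (chi : sigma_phase R) (k : int) : ProperFilter F -> boundary chi ->
  point_eval (x i) @[i --> F] --> chi ->
  \forall i \near F, ((x i).1 : int) != k.
Proof.
move=> FF chib xchi.
pose g := Buc (index_indicator_buc k); pose h := Buc circle_coord_buc.
have [_ chiM _] : is_character (\val chi) by exact: set_mem (valP chi).
(* The indicator [g] is idempotent, hence a character sends it to 0 or 1. *)
have gg : \val chi g * \val chi g = \val chi g.
  rewrite -chiM; congr (\val chi _); apply/val_inj/funext => y /=.
  rewrite -[LHS]/(index_indicator k y * index_indicator k y) /index_indicator.
  by rewrite -natrM mulnb andbb.
have xg : g (x i) @[i --> F] --> \val chi g by exact: sigma_phase_cvg.
have xh : h (x i) @[i --> F] --> \val chi h by exact: sigma_phase_cvg.
have half : ((1 : C) < (2^-1 : R)%:C) = false.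
  by rewrite -(rmorph1 (real_complex R)) ltcR ltNge invf_le1 ?ler1n.
have near_g : \forall i \near F, `|g (x i) - \val chi g| < (2^-1 : R)%:C.
  by move/cvg_complexP : xg; apply; rewrite invr_gt0.
(* Values of [g] are 0 or 1, so being within 1/2 of the limit means being equal to it. Limit 0 is
   the claim; limit 1 fixes the index at [k] and must contradict [chib]. *)
have [chig|chig] := eqVneq (\val chi g) 0.
  apply: filterS near_g => i; rewrite chig subr0 /= /index_indicator.
  by case: eqP => // _; rewrite normr1 half.
have {}chig : \val chi g = 1 by apply: (mulfI chig); rewrite gg mulr1.
have x1 : \forall i \near F, (x i).1 = k.
  apply: filterS near_g => i; rewrite chig /= /index_indicator.
  by case: eqP => // _; rewrite sub0r normrN normr1 half.
exfalso; apply: chib.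
(* A limit of unimodular numbers is unimodular, so [\val chi h] is a point of the circle. *)
have hn : `|\val chi h| = 1.
  apply/eqP; rewrite -subr_eq0; apply/eqP.
  apply: (@complex_eq0_small R _ 1) => // e e0; rewrite mul1r.
  move/cvg_complexP : xh => /(_ e e0)/filter_ex[i /ltW]; apply: le_trans.
  by rewrite -(circle_norm (x i).2) distrC ler_dist_dist.
(* The net converges to [y] inside the phase space, so [chi] is evaluation at [y], against
   [chib]. *)
pose y : phase R := (k, SigSub (mem_set hn)).
exists y => //; apply/val_inj/funext => f /=.
have h1 : f (x i) @[i --> F] --> \val chi f by exact: sigma_phase_cvg.
have h2 : f (x i) @[i --> F] --> f y by exact: (@buc_cvg _ _ x y f _ x1 xh).
exact: cvg_complex_unique h2 h1.
Qed.

End boundary_nets.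

(** * Membership in [B0] and compact operators *)

Section compact_operators_vanish.
Variable R : realType.
Local Notation C := R[i].
Implicit Types (A B : bounded_op R) (a b phi : l2 R).

Lemma tails_filter (I : Type) (le : I -> I -> Prop) : directed le -> ProperFilter (tails le).
Proof.
move=> [[i0] refl trans dir]; apply: filter_from_proper; last by move=> i _; exists i.
apply: filter_from_filter; first by exists i0.
move=> i j _ _; have [k [ik jk]] := dir i j; exists k => // l kl.
by split; [exact: trans ik kl|exact: trans jk kl].
Qed.

(** Conjugation commutes with taking adjoints, so the second SOT* seminorm is the first one for
    [adjoint B]. *)
Lemma null_on_basis_B0 B : null_on_basis B -> null_on_basis (adjoint B) -> B0 R B.
Proof.
move=> Bnull B'null I le dir x chi chib xchi phi.
pose FF := tails_filter dir.
have xoo k : \forall i \near tails le, ((x i).1 : int) != k.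
  by exact: boundary_index_neq xchi.
split; first by apply: norm_small_cvg0 => e e0; exact: alpha_small.
have -> : (fun i => `|adjoint (alpha (x i) B) phi|) =
    (fun i => `|alpha (x i) (adjoint B) phi|).
  by apply/funext => i; rewrite adjoint_alpha.
by apply: norm_small_cvg0 => e e0; exact: alpha_small.
Qed.

Definition cofinite_filter : set_system int :=
  filter_from [set: {fset int}] (fun F => [set n | n \notin F]).

Lemma cofinite_filter_filter : Filter cofinite_filter.
Proof.
apply: filter_fromT_filter; first by exists fset0.
by move=> F G; exists (F `|` G)%fset => n /=; rewrite inE negb_or => /andP[].
Qed.

Lemma near_l2 a (d : R) : 0 < d -> \forall b \near a, l2_norm (b - a) < d.
Proof.
move=> d0; apply/nbhs_ballP; exists d%:C; first by rewrite /= ltcR.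
by move=> b; rewrite -ball_normE /= distrC l2_normE ltcR.
Qed.

(** An equi-Lipschitz family that tends to 0 pointwise does so uniformly on compact sets, here the
    closure of the image of the unit ball. Compactness enters in its near-covering form, with the
    cofinite filter on the index. *)
Lemma compact_uniform_small A (u : int -> l2 R -> C) (L e : R) :
  compact_operators R A -> 0 <= L -> 0 < e ->
  (forall n a b, `|u n a - u n b| <= (L * l2_norm (a - b))%:C) ->
  (forall a (d : R), 0 < d ->
    exists F : {fset int}, forall n, n \notin F -> `|u n a| <= d%:C) ->
  exists F : {fset int}, forall n phi,
    n \notin F -> `|phi| <= 1 -> `|u n (A phi)| <= e%:C.
Proof.
rewrite /compact_operators /= precompactE => /compact_near_coveringP cK L0 e0 uL uc.
have FF := cofinite_filter_filter.
have L1 : 0 < L + 1 by rewrite ltr_wpDl.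
have e2 : 0 < e / 2 by rewrite divr_gt0.
have [F _ hF] : \forall n \near cofinite_filter,
    closure [set A phi | phi in [set phi : l2 R | `|phi| <= 1]] `<=`
      (fun a => `|u n a| <= e%:C).
  apply: cK => a _; have [F hF] := uc a _ e2.
  (* On this ball [u n] moves by at most [e / 2], and off [F] its value at the centre is at most
     [e / 2]. *)
  exists ([set b | l2_norm (b - a) < e / 2 / (L + 1)], [set n | n \notin F]).
    by split; [exact: near_l2 (divr_gt0 e2 L1)|exists F].
  move=> [b n] /= [ab nF]; rewrite -[u n b](subrK (u n a)) (splitr e) rmorphD /=.
  apply: le_trans (ler_normD _ _) (lerD _ (hF n nF)).
  apply: le_trans (uL n b a) _; rewrite lecR.
  apply: le_trans (ler_wpM2l L0 (ltW ab)) _.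
  by rewrite mulrCA ger_pMr// ler_pdivrMr// mul1r lerDl.
exists F => n phi nF phi1; apply: (hF n nF); apply: subset_closure.
by exists phi.
Qed.

(** Take for [u n] the inner product with A e_n. It is null at each [a], being the n-th coordinate
    of A^* a, and its value at A e_n is |A e_n|^2. *)
Lemma compact_null_on_basis A : compact_operators R A -> null_on_basis A.
Proof.
move=> cA e e0; have [M M0 AM] := op_bound A.
have e2 : 0 < e ^+ 2 by rewrite exprn_gt0.
have M4 : 0 <= 4 * M by rewrite mulr_ge0.
have [||F hF] := @compact_uniform_small A
  (fun n a => inner a (A (l2_basis R n))) (4 * M) _ cA M4 e2.
- move=> n a b; rewrite -innerBl; apply: le_trans (inner_leR _ _) _; rewrite lecR.
  rewrite -!mulrA ler_pM2l// mulrC ler_wpM2r ?l2_norm_ge0//.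
  by apply: le_trans (AM _) _; rewrite l2_norm_basis mulr1.
- move=> a d d0; have [F hF] := coord_cvg0 (adjoint A a) d0; exists F => n nF.
  by rewrite -(is_adjoint_sym (adjointP A)) inner_basisr hF.
exists F => n nF; have := hF n (l2_basis R n) nF; rewrite norm_basis lexx => /(_ isT).
rewrite inner_self normrX normr_id l2_normE -rmorphXn lecR.
by rewrite ler_pXn2r// nnegrE ?l2_norm_ge0 ?ltW.
Qed.

(** This avoids compactness of the adjoint. Take for [u n] the n-th coordinate: with psi = A^* e_n,
    that of A psi is |psi|^2. *)
Lemma compact_adjoint_null_on_basis A : compact_operators R A -> null_on_basis (adjoint A).
Proof.
move=> cA e e0; have [M M0 AM] := op_bound (adjoint A).
have M1 : 0 < M + 1 by rewrite ltr_wpDl.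
(* Dividing psi by [M + 1] brings it into the unit ball; the threshold carries the same factor. *)
have e2 : 0 < e ^+ 2 / (M + 1) by rewrite divr_gt0 ?exprn_gt0.
have [||F hF] := @compact_uniform_small A (fun n a => a n) 1 _ cA ler01 e2.
- by move=> n a b; rewrite mul1r -l2_normE; exact: (norm_coord_le (a - b)).
- by move=> a d; exact: coord_cvg0.
exists F => n nF; set psi := adjoint A _.
have psiM : l2_norm psi <= M by apply: le_trans (AM _) _; rewrite l2_norm_basis mulr1.
have kC : `|((M + 1)^-1)%:C| = ((M + 1)^-1)%:C :> C.
  by rewrite ger0_norm// lecR invr_ge0 ltW.
have := hF n (((M + 1)^-1)%:C *: psi) nF.
rewrite normrZ kC l2_normE -rmorphM lecR.
have psiM1 : l2_norm psi <= M + 1 by rewrite (le_trans psiM)// lerDl.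
rewrite mulrC ler_pdivrMr// mul1r => /(_ psiM1).
rewrite -inner_basisr adjointP innerZl inner_self -/psi.
rewrite normrM kC normrX normr_id l2_normE -rmorphXn -rmorphM lecR.
rewrite mulrC ler_pM2r ?invr_gt0//.
by rewrite ler_pXn2r// nnegrE ?l2_norm_ge0 ?ltW.
Qed.

End compact_operators_vanish.

(** * The projection onto the span of the dyadic block vectors *)

Section dyadic_projection.
Variable R : realType.
Local Notation C := R[i].
Implicit Types (phi psi : l2 R).

Definition dyadic_log (n : int) : nat := if n is Posz m then trunc_log 2 m else 0%N.

(* The weight vanishes at n <= 0, where the value of dyadic_log is junk. *)
Definition dyadic_weight (n : int) : R :=
  if n is Posz m.+1 then 2 ^- dyadic_log m.+1 else 0.

(** The integers from 2^m to 2^(m+1) - 1, written as an image so that [esum_image] reduces a block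
    sum to 2^m terms. *)
Definition dyadic_block (m : nat) : set int :=
  [set Posz (2 ^ m + j) | j in `I_(2 ^ m)].

(** The partial isometry V that sends e_m to f_m for m >= 0 and kills e_m for m < 0. *)
Definition dyadic_fun (a : int -> C) : int -> C :=
  fun n => (Num.sqrt (dyadic_weight n))%:C * a (dyadic_log n).

Lemma dyadic_weight_ge0 n : 0 <= dyadic_weight n.
Proof. by case: n => [[|n]|n] //; rewrite invr_ge0 exprn_ge0. Qed.

Lemma modsq_dyadic_fun a n :
  modsq (dyadic_fun a n) = dyadic_weight n * modsq (a (dyadic_log n)).
Proof.
rewrite modsqM; congr (_ * _).
by rewrite /modsq /= expr0n addr0 sqr_sqrtr ?dyadic_weight_ge0.
Qed.

Lemma dyadic_log_block m n : dyadic_block m n -> dyadic_log n = m.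
Proof.
move=> [j /= jm <-] /=; apply: trunc_log_eq => //.
by rewrite leq_addr /= expnS mul2n -addnn ltn_add2l.
Qed.

Lemma dyadic_weight_block m n : dyadic_block m n -> dyadic_weight n = 2 ^- m.
Proof.
move=> h; have := dyadic_log_block h; case: h => j /= jm <-.
have := expn_gt0 2 m; rewrite /dyadic_weight; case: (2 ^ m)%N => // k _.
by rewrite addSn => ->.
Qed.

Lemma dyadic_weight_neq0 n : dyadic_weight n != 0 -> (\bigcup_m dyadic_block m) n.
Proof.
case: n => [[|n]|n]; rewrite /= ?eqxx// => _.
have /andP[h1 h2] := @trunc_log_bounds 2 n.+1 isT isT.
exists (trunc_log 2 n.+1) => //; exists (n.+1 - 2 ^ trunc_log 2 n.+1)%N => /=.
  by rewrite ltn_subLR// addnn -mul2n -expnS.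
by rewrite subnKC.
Qed.

(** The blocks partition the positive integers, and block m contributes 2^m equal terms of weight
    2^(-m). *)
Lemma dyadic_mass (a : int -> C) :
  l2_mass (dyadic_fun a) = (\esum_(m in [set: nat]) (modsq (a (Posz m)))%:E)%E.
Proof.
have f0 n : (0 <= (modsq (dyadic_fun a n))%:E)%E by rewrite lee_fin modsq_ge0.
transitivity (\esum_(n in \bigcup_m dyadic_block m) (modsq (dyadic_fun a n))%:E)%E.
  rewrite [RHS]esum_mkcond; apply: eq_esum => n _.
  case: ifPn => // /negP h; rewrite modsq_dyadic_fun.
  have [->|/dyadic_weight_neq0 /mem_set//] := eqVneq (dyadic_weight n) 0.
  by rewrite mul0r.
rewrite esum_bigcupT//; last first.
  by move=> m m' _ _ [n [/dyadic_log_block <- /dyadic_log_block <-]].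
apply: eq_esum => m _.
transitivity (\esum_(n in dyadic_block m) (2 ^- m * modsq (a (Posz m)))%:E)%E.
  apply: eq_esum => n nm; rewrite modsq_dyadic_fun.
  by rewrite (dyadic_weight_block nm) (dyadic_log_block nm).
rewrite esum_image; last by move=> i j _ _ [] /addnI.
rewrite esum_fset//;
  last by move=> i _; rewrite lee_fin mulr_ge0 ?modsq_ge0// invr_ge0 exprn_ge0.
rewrite -(fsbig_ord _ _ (fun=> (2 ^- m * modsq (a (Posz m)))%:E)).
rewrite sumEFin sumr_const card_ord.
by rewrite -mulrnAl -[2 ^- m *+ _]mulr_natl natrX mulfV ?mul1r.
Qed.

Lemma dyadic_mass_le (a : int -> C) : (l2_mass (dyadic_fun a) <= l2_mass a)%E.
Proof.
rewrite dyadic_mass -(@esum_image R _ _ setT Posz (fun n => (modsq (a n))%:E)); last first.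
  by move=> i j _ _ [].
rewrite esum_mkcond; apply: le_esum => n _.
by case: ifP => // _; rewrite lee_fin modsq_ge0.
Qed.

Lemma dyadic_l2_subproof phi : dyadic_fun phi \in @l2_pred R.
Proof.
by apply/asboolP; apply: le_lt_trans (dyadic_mass_le _) _; rewrite -l2_mass_fin ltry.
Qed.

Definition dyadic_l2 phi : l2 R := L2 (dyadic_l2_subproof phi).

Lemma dyadic_linear : linear dyadic_l2.
Proof.
move=> c a b; apply: l2P => n.
by rewrite /= /dyadic_fun /= mulrDr mulrCA.
Qed.

HB.instance Definition _ := GRing.isLinear.Build C (l2 R) (l2 R) _ dyadic_l2 dyadic_linear.

Lemma l2_norm_dyadic_le phi : l2_norm (dyadic_l2 phi) <= l2_norm phi.
Proof.
rewrite ler_sqrt ?fine_mass_ge0// -lee_fin !l2_mass_fin; exact: dyadic_mass_le.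
Qed.

Lemma dyadic_bounded : exists M : C, forall phi, `|dyadic_l2 phi| <= M * `|phi|.
Proof. by exists 1 => phi; rewrite mul1r !l2_normE lecR l2_norm_dyadic_le. Qed.

Definition dyadic_op : bounded_op R := BoundedOp dyadic_bounded.

(** Since V is a partial isometry, V V^* is the orthogonal projection onto its range, the closed
    span of the f_m. *)
Definition dyadic_projection := op_comp dyadic_op (adjoint dyadic_op).

Lemma l2_norm_dyadic_basis (m : nat) : l2_norm (dyadic_op (l2_basis R m)) = 1.
Proof.
rewrite /l2_norm [l2_mass _](dyadic_mass (basis_fun R m)).
rewrite [X in fine X](_ : _ = 1%E) ?sqrtr1//.
transitivity (\esum_(i in [set m]) 1 : \bar R)%E; last by rewrite esum_set1.
rewrite [RHS]esum_mkcond; apply: eq_esum => i _; rewrite /basis_fun.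
have -> : (i \in [set m]) = (Posz i == Posz m).
  by apply/idP/eqP => [/set_mem ->|[->]]//; exact: mem_set.
by case: eqP => _; rewrite /modsq /= ?expr1n expr0n addr0.
Qed.

Lemma adjoint_dyadic_basis n :
  adjoint dyadic_op (l2_basis R n) =
  (Num.sqrt (dyadic_weight n))%:C *: l2_basis R (dyadic_log n).
Proof.
apply: l2P => m; apply: (inv_inj (@conjCK _)).
rewrite -inner_basisl -adjointP inner_basisr.
transitivity ((Num.sqrt (dyadic_weight n))%:C * (Posz (dyadic_log n) == m)%:R : C) => //.
rewrite -[LHS]conjCK; congr (_^*).
rewrite rmorphM /= rmorph_nat eq_sym; congr (_ * _).
by rewrite geC0_conj// lecR sqrtr_ge0.
Qed.

Lemma is_adjoint_dyadic_projection : is_adjoint dyadic_projection dyadic_projection.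
Proof.
move=> phi psi.
rewrite -[LHS]/(inner (dyadic_op _) psi) adjointP.
by rewrite -(is_adjoint_sym (adjointP dyadic_op)).
Qed.

Lemma dyadic_projection_null : null_on_basis dyadic_projection.
Proof.
(* The norm of P e_n is the square root of the weight of n, and 2^L > L > e^(-2) makes weights up to
   2^(-L) small enough. *)
move=> e e0; pose L := (Num.truncn (e ^- 2)).+1.
have eL : 2 ^- L <= e ^+ 2.
  rewrite -[leRHS]invrK lef_pV2 ?posrE ?exprn_gt0 ?invr_gt0 ?exprn_gt0//.
  apply: ltW; apply: lt_le_trans (truncnS_gt _) _.
  by rewrite -natrX ler_nat ltnW// ltn_expl.
(* Excluding 0, ..., 2^L - 1 leaves negative n, of weight 0, and n >= 2^L, of weight at most
   2^(-L). *)
exists [fset Posz (val i) | i in 'I_(2 ^ L)]%fset => n nL.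
rewrite /= adjoint_dyadic_basis linearZ /= l2_normZR.
rewrite (l2_norm_dyadic_basis (dyadic_log n)) mulr1.
have -> x : modsq (Num.sqrt x)%:C = (Num.sqrt x) ^+ 2 :> R.
  by rewrite /modsq /= expr0n addr0.
rewrite sqrtr_sqr ger0_norm ?sqrtr_ge0// -[leRHS](ger0_norm (ltW e0)) -sqrtr_sqr.
apply: ler_wsqrtr; apply: le_trans eL.
case: n nL => [[|n]|n] nL; rewrite /= ?invr_ge0 ?exprn_ge0//.
rewrite lef_pV2 ?posrE ?exprn_gt0// ler_eXn2l ?ltr1n//.
rewrite -[leqLHS](@trunc_expnK 2)//; apply: leq_trunc_log.
rewrite leqNgt; apply: contra nL => h; apply/imfsetP => /=.
by exists (Ordinal h).
Qed.

Lemma exists_nat_notin (F : {fset int}) : exists m : nat, Posz m \notin F.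
Proof.
exists (\max_(n <- F) `|n|%N).+1; apply/negP => mF.
have := @leq_bigmax_seq _ (enum_fset F) xpredT (fun n : int => `|n|%N) _ mF isT.
by rewrite /= ltnn.
Qed.

(** If P were compact, so would be P V, as V is a contraction, and P V e_m = P f_m would tend to 0.
    But the inner product of P f_m with f_m is |V^* f_m|^2, at least 1 because V^* f_m has m-th
    coordinate 1. *)
Lemma dyadic_projection_not_compact : ~ compact_operators R dyadic_projection.
Proof.
move=> cP; pose A := op_comp dyadic_projection dyadic_op.
have cA : compact_operators R A.
  apply: precompact_subset cP => _ [phi /= phi1 <-]; exists (dyadic_op phi) => //=.
  by apply: le_trans phi1; rewrite !l2_normE lecR l2_norm_dyadic_le.
(* Any bound below 1/4 contradicts 1 <= 4 |P f_m|. *)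
have e8 : 0 < 8^-1 :> R by rewrite invr_gt0.
have [F hF] := compact_null_on_basis cA e8.
have [m mF] := exists_nat_notin F.
set v := dyadic_op (l2_basis R m).
have v1 : l2_norm v = 1 by exact: l2_norm_dyadic_basis.
have w1 : 1 <= `|adjoint dyadic_op v|.
  apply: le_trans (norm_coord_le _ m); rewrite -inner_basisr.
  rewrite (is_adjoint_sym (adjointP dyadic_op)) inner_self.
  by rewrite l2_normE v1 !rmorph1 expr1n normr1.
have := inner_leR (dyadic_projection v) v.
rewrite v1 mulr1 -[inner _ _]/(inner (dyadic_op _) v) adjointP inner_self normrX normr_id.
have w2 : 1 <= `|adjoint dyadic_op v| ^+ 2 by rewrite exprn_ege1.
move=> /(le_trans w2); rewrite -(rmorph1 (real_complex R)) lecR.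
have := hF m mF; rewrite -/v /=; lra.
Qed.

End dyadic_projection.

Theorem proposition3p25 (R : realType) :
  compact_operators R `<=` B0 R /\
  exists2 A : bounded_op R, B0 R A & ~ compact_operators R A.
Proof.
split=> [A cA|].
  exact: null_on_basis_B0 (compact_null_on_basis cA) (compact_adjoint_null_on_basis cA).
exists (dyadic_projection R); last exact: dyadic_projection_not_compact.
apply: null_on_basis_B0; first exact: dyadic_projection_null.
move=> e e0; have [F hF] := dyadic_projection_null e0; exists F => n nF.
(* The projection is self-adjoint, so its own estimate covers the adjoint. *)
rewrite (is_adjoint_unique (adjointP _) (@is_adjoint_dyadic_projection R)).
exact: hF.
Qed.
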